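(* Let $\Gamma=(\mathcal V,b,c)$ be a canonically compactifiable weighted graph over $(\mathcal V,m)$. Suppose $$\inf_{\mathcal K\subset\mathcal V,\ m(\mathcal K)<\infty}\ \sum_{x\in\mathcal V\setminus\mathcal K}\frac{(m(x))^2}{m(x)+c(x)}<\infty.$$ Then $E\hookrightarrow\ell^p_m$ (continuous embedding) for all $p\in[1,\infty]$.
   Context: Let $\mathcal V$ be an infinite countable set and $m:\mathcal V\to(0,\infty)$; put $m(A)=\sum_{x\in A}m(x)$ for $A\subset\mathcal V$. A weighted graph $\Gamma=(\mathcal V,b,c)$ over $(\mathcal V,m)$ consists of an edge weight $b:\mathcal V\times\mathcal V\to[0,\infty)$ with $b(x,x)=0$, $b(x,y)=b(y,x)$, $\sum_{y}b(x,y)<\infty$ for all $x,y\in\mathcal V$, and a killing term $c:\mathcal V\to[0,\infty)$. Write $x\sim y$ iff $b(x,y)>0$. Put $V(x)=\frac{c(x)+m(x)}{m(x)}\ge 1$ and $\Delta u(x)=\frac1{m(x)}\sum_{y\sim x}b(x,y)(u(y)-u(x))$. For $p\in[1,\infty)$, $\ell^p_m$ is the space of $u:\mathcal V\to\mathbb R$ with $\|u\|_{\ell^p_m}^p=\sum_x m(x)|u(x)|^p<\infty$; $\ell^\infty_m=\ell^\infty$ is the space of bounded functions with sup-norm. Forms: $q^{(N)}(u)=\frac12\sum_{x,y\in\mathcal V,\,x\sim y}b(x,y)(u(y)-u(x))^2+\sum_x m(x)V(x)u(x)^2$ with domain $D(q^{(N)})=\{u\in\ell^2_m: q^{(N)}(u)<\infty\}$,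 normed by $q^{(N)}(u)^{1/2}$. $q^{(D)}$ is the closure in $\ell^2_m$ of the form $q_0(u)=\sum_x m(x)(-\Delta u(x)+V(x)u(x))u(x)$ on finitely supported functions. Fix a closed form $q$ with $D(q^{(D)})\subset D(q)\subset D(q^{(N)})$ and $q=q^{(N)}$ on $D(q)$; $E=D(q)$ is a Hilbert space with norm $\|u\|_E=q(u)^{1/2}$. $\Gamma$ is canonically compactifiable if $D(q^{(N)})$ embeds continuously into $\ell^\infty$. Standing assumption of the paper: $\sup_{\mathcal K\Subset\mathcal V,\ m(\mathcal K)<\infty}\ \inf_{x\in\mathcal V\setminus\mathcal K}V(x)=\infty$ (with $\inf\emptyset=+\infty$), where $\mathcal K\Subset\mathcal V$ means that $u\mapsto\chi_{\mathcal K}u$ is a continuous operator $D(q^{(N)})\to\ell^\infty$. *)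

(* Defs.v *)
From HB Require Import structures.
From mathcomp Require Import all_boot all_order all_algebra.
From mathcomp Require Import all_classical all_reals all_analysis.
Set Implicit Arguments.
Unset Strict Implicit.
Unset Printing Implicit Defensive.
Import Order.TTheory GRing.Theory Num.Theory.
Import numFieldNormedType.Exports.
Local Open Scope classical_set_scope.
Local Open Scope ring_scope.

Record weighted_graph (R : realType) (V : countType) := WeightedGraph {
  edge : V -> V -> R;
  killing : V -> R;
  edge_ge0 : forall x y, 0 <= edge x y;
  edge_diag : forall x, edge x x = 0;
  edge_sym : forall x y, edge x y = edge y x;
  edge_summable : forall x, (\esum_(y in [set: V]) (edge x y)%:E < +oo)%E;
  killing_ge0 : forall x, 0 <= killing x
}.

(* A vector space of real functions on V with a norm.  The value [fsnorm u]
   is meaningful only for [u] in [fscarrier]. *)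
Record function_space (R : realType) (V : Type) := FunctionSpace {
  fscarrier : set (V -> R);
  fsnorm : (V -> R) -> R
}.

Definition continuous_operator (R : realType) (V : Type)
    (X Y : function_space R V) (T : (V -> R) -> (V -> R)) : Prop :=
  (forall u, fscarrier X u -> fscarrier Y (T u)) /\
  (forall u, fscarrier X u -> forall e : R, 0 < e ->
     exists2 d : R, 0 < d & forall v, fscarrier X v ->
       fsnorm X (v \- u) < d -> fsnorm Y (T v \- T u) < e).

Definition continuously_embedded (R : realType) (V : Type)
    (X Y : function_space R V) : Prop :=
  continuous_operator X Y (fun u => u).

(* [qval u] is meaningful only for [u] in [qdom]. *)
Record qform (R : realType) (V : Type) := QForm {
  qdom : set (V -> R);
  qval : (V -> R) -> R
}.

Definition form_space (R : realType) (V : Type) (q : qform R V)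
    : function_space R V :=
  FunctionSpace (qdom q) (fun u => Num.sqrt (qval q u)).

(* Unconditional sum of a real family over A, for absolutely summable f
   ([\esum] is only meant for nonnegative families). *)
Definition rsum (R : realType) (V : choiceType) (A : set V) (f : V -> R) : R :=
  fine (\esum_(x in A) (Num.max (f x) 0)%:E)
  - fine (\esum_(x in A) (Num.max (- f x) 0)%:E).

Section WeightedSpaces.
Context (R : realType) (V : countType) (m : V -> R).
Implicit Types (u : V -> R) (K : set V) (q : qform R V).

Definition mass K : \bar R := \esum_(x in K) (m x)%:E.

Definition lp_finite (r : R) : function_space R V :=
  let S u := \esum_(x in [set: V]) (m x * `|u x| `^ r)%:E in
  FunctionSpace [set u | (S u < +oo)%E] (fun u => fine (S u) `^ r^-1).

Definition l_infty : function_space R V :=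
  FunctionSpace [set u | has_ubound (range (fun x => `|u x|))]
                (fun u => sup (range (fun x => `|u x|))).

(* The exponent -oo is a junk case. *)
Definition lp (p : \bar R) : function_space R V :=
  match p with
  | r%:E => lp_finite r
  | _ => l_infty
  end.

Definition l2 := lp 2%:E.

(* A nonnegative quadratic form on a linear subspace of l2: the diagonal of a
   symmetric bilinear form on its domain. *)
Definition quadratic_form q : Prop :=
  [/\ qdom q `<=` fscarrier l2,
      qdom q (fun=> 0),
      forall (a : R) u v, qdom q u -> qdom q v ->
        qdom q (fun x => a * u x + v x),
      forall u, qdom q u -> 0 <= qval q u &
      exists B : (V -> R) -> (V -> R) -> R,
        [/\ forall u v, qdom q u -> qdom q v -> B u v = B v u,
            forall (a : R) u v w, qdom q u -> qdom q v -> qdom q w ->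
              B (fun x => a * u x + v x) w = a * B u w + B v w &
            forall u, qdom q u -> qval q u = B u u]].

Definition closed_form q : Prop :=
  quadratic_form q /\
  forall f : nat -> V -> R, (forall n, qdom q (f n)) ->
    (forall e : R, 0 < e -> exists N, forall n k, (N <= n)%N -> (N <= k)%N ->
       qval q (f n \- f k) + fsnorm l2 (f n \- f k) ^+ 2 < e) ->
    exists2 u, qdom q u &
      (qval q (f n \- u) + fsnorm l2 (f n \- u) ^+ 2) @[n --> \oo] --> (0 : R).

(* f is a q0-Cauchy sequence in the domain of q0 converging to u in l2. *)
Definition form_approx (q0 : qform R V) (f : nat -> V -> R) u : Prop :=
  [/\ forall n, qdom q0 (f n),
      fsnorm l2 (f n \- u) @[n --> \oo] --> (0 : R) &
      forall e : R, 0 < e -> exists N, forall n k, (N <= n)%N -> (N <= k)%N ->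
        qval q0 (f n \- f k) < e].

(* Closure in l2 of a closable form q0: its value at u is the limit of
   q0 (f n), which does not depend on the approximating sequence f. *)
Definition form_closure (q0 : qform R V) : qform R V :=
  QForm [set u | fscarrier l2 u /\ exists f, form_approx q0 f u]
        (fun u => xget 0 [set r | exists2 f, form_approx q0 f u &
                                    qval q0 (f n) @[n --> \oo] --> r]).

Section Graph.
Variable G : weighted_graph R V.

Definition graph_adj (x y : V) : Prop := 0 < edge G x y.

Definition potential (x : V) : R := (killing G x + m x) / m x.

Definition laplacian u (x : V) : R :=
  (m x)^-1 * rsum [set y | graph_adj x y] (fun y => edge G x y * (u y - u x)).

Definition energyN u : \bar R :=
  ((2^-1)%:E * (\esum_(xy in [set xy : V * V | graph_adj xy.1 xy.2])
     (edge G xy.1 xy.2 * (u xy.2 - u xy.1) ^+ 2)%:E)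
   + \esum_(x in [set: V]) (m x * potential x * u x ^+ 2)%:E)%E.

Definition neumann_form : qform R V :=
  QForm [set u | fscarrier l2 u /\ (energyN u < +oo)%E]
        (fun u => fine (energyN u)).

Definition finitely_supported_form : qform R V :=
  QForm [set u | finite_set [set x | u x <> 0]]
        (fun u => \sum_(x \in [set: V])
           (m x * (- laplacian u x + potential x * u x) * u x)).

Definition dirichlet_form : qform R V := form_closure finitely_supported_form.

Definition canonically_compactifiable : Prop :=
  continuously_embedded (form_space neumann_form) l_infty.

(* The relation written K ⋐ V, with V the whole vertex set. *)
Definition relatively_bounded K : Prop :=
  continuous_operator (form_space neumann_form) l_infty (fun u x => \1_K x * u x).

Definition potential_blows_up : Prop :=
  ereal_sup [set ereal_inf [set (potential x)%:E | x in ~` K]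
            | K in [set K | relatively_bounded K /\ (mass K < +oo)%E]]
  = +oo%E.

End Graph.
End WeightedSpaces.

(* Main.v *)
(* Pick K of finite mass off which m^2 / (m + c) is summable, and put g = m on
   K, g = m^2 / (m + c) off K.  Then g is summable and m^2 <= g (m + c), so by
   Young's inequality m |w| <= t g + t^-1 (m + c) w^2 for all t > 0; summing,
   the l^1 norm of w is at most t M + t^-1 q(w).  Boundedness of w turns this
   into a bound of the sum of m |w|^r, and continuity at 0 follows by choosing
   t small first and then q(w) small. *)
Require Import Defs.
From HB Require Import structures.
From mathcomp Require Import all_boot all_order all_algebra.
From mathcomp Require Import all_classical all_reals all_analysis.
From mathcomp Require Import ring lra.
Import Order.TTheory GRing.Theory Num.Theory.
Local Open Scope classical_set_scope.
Local Open Scope ring_scope.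

Lemma esumZl_le (R : realType) (T : choiceType) (A : set T) (k : R)
    (a : T -> R) : 0 <= k -> (forall x, 0 <= a x) ->
  (\esum_(x in A) (k * a x)%:E <= k%:E * \esum_(x in A) (a x)%:E)%E.
Proof.
move=> k0 a0; apply: ge_ereal_sup => _ [X XA <-].
under eq_fsbigr do rewrite EFinM.
rewrite -ge0_mule_fsumr; last by move=> x; rewrite lee_fin.
apply: lee_wpmul2l; first by rewrite lee_fin.
by apply: ereal_sup_ubound; exists X.
Qed.

(** Compare squares: with P and Q the two summands on the right, the parameter [t] cancels in PQ = g
    h w^2, which dominates a^2 w^2, and PQ <= (P + Q)^2 since P, Q >= 0. *)
Lemma weighted_young (R : realType) (a g h w t : R) :
  0 <= a -> 0 <= g -> 0 <= h -> 0 < t -> a ^+ 2 <= g * h ->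
  a * `|w| <= t * g + t^-1 * (h * w ^+ 2).
Proof.
move=> a0 g0 h0 t0 agh.
have P0 : 0 <= t * g by rewrite mulr_ge0 // ltW.
have Q0 : 0 <= t^-1 * (h * w ^+ 2).
  by rewrite mulr_ge0 ?invr_ge0 ?(ltW t0) // mulr_ge0 ?sqr_ge0.
rewrite -(@ler_pXn2r _ 2) ?nnegrE ?mulr_ge0 ?addr_ge0 //.
rewrite exprMn real_normK ?num_real //.
have PQ : (t * g) * (t^-1 * (h * w ^+ 2)) = g * h * w ^+ 2.
  by field; rewrite gt_eqF.
apply: (@le_trans _ _ (g * h * w ^+ 2)); first by rewrite ler_wpM2r ?sqr_ge0.
by rewrite -PQ; nra.
Qed.

(** By scaling: a / B lies in [0, 1], where the r-th power is at most the identity, and a / B <= a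
    because B >= 1. This reduces the l^r sum of a bounded function to its l^1 sum. *)
Lemma powR_le_linear (R : realType) (a B r : R) :
  0 <= a <= B -> 1 <= B -> 1 <= r -> a `^ r <= B `^ r * a.
Proof.
move=> /andP[a0 aB] B1 r1; have B0 : 0 < B by lra.
have [->|an0] := eqVneq a 0; first by rewrite powR0 ?mulr0 //; lra.
have a_gt0 : 0 < a by rewrite lt0r an0.
have aB0 : 0 < a / B by rewrite divr_gt0.
rewrite -{1}[a](divfK (lt0r_neq0 B0)) [a / B * B]mulrC.
rewrite powRM ?(ltW B0) ?(ltW aB0) //.
rewrite ler_wpM2l ?powR_ge0 //; apply: (@le_trans _ _ (a / B)).
  by rewrite ge1r_powR // aB0 ler_pdivrMr // mul1r.
by rewrite ler_pdivrMr // ler_peMr.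
Qed.

Section Embedding.
Context (R : realType) (V : countType) (m : V -> R) (G : weighted_graph R V).
Context (m_gt0 : forall x, 0 < m x).

(** Since m V = m + c, this is the energy without its nonnegative edge part. *)
Lemma esum_potential_le_energyN (u : V -> R) :
  (\esum_(x in [set: V]) ((m x + killing G x) * u x ^+ 2)%:E
     <= energyN m G u)%E.
Proof.
rewrite /energyN.
rewrite (@eq_esum _ _ _ _ (fun x => (m x * potential m G x * u x ^+ 2)%:E)).
  rewrite leeDr // mule_ge0 ?lee_fin ?invr_ge0 //.
  by apply: esum_ge0 => x _; rewrite lee_fin mulr_ge0 ?sqr_ge0 ?edge_ge0.
move=> x _; congr (_%:E); rewrite /potential; field.
by rewrite gt_eqF.
Qed.

Lemma energyN_ge0 (u : V -> R) : (0 <= energyN m G u)%E.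
Proof.
apply: le_trans (esum_potential_le_energyN u); apply: esum_ge0 => x _.
by rewrite lee_fin mulr_ge0 ?sqr_ge0 // addr_ge0 ?killing_ge0 // ltW.
Qed.

(** [M] is the sum of g, fixed before [r], [B], [t] and [u], so that [t] may later be chosen in
    terms of [M]. *)
Lemma esum_lp_le_energyN :
  (ereal_inf [set \esum_(x in ~` K) (m x ^+ 2 / (m x + killing G x))%:E
             | K in [set K : set V | mass m K < +oo]] < +oo)%E ->
  exists2 M : R, 0 <= M & forall (r B t : R) (u : V -> R),
    1 <= r -> 1 <= B -> 0 < t -> (forall x, `|u x| <= B) ->
    (\esum_(x in [set: V]) (m x * `|u x| `^ r)%:E
       <= (B `^ r * t * M)%:E + (B `^ r / t)%:E * energyN m G u)%E.
Proof.
move=> /ereal_inf_lt[_ [K /= mK <-] tailK].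
pose h x := m x + killing G x.
have h_gt0 x : 0 < h x by rewrite ltr_wpDr ?killing_ge0.
pose g x := if x \in K then m x else m x ^+ 2 / h x.
have g0 x : 0 <= g x.
  by rewrite /g; case: ifP => _; rewrite ?divr_ge0 ?sqr_ge0 // ltW.
(* Equality off [K]; on [K] it amounts to m <= m + c. *)
have mgh x : m x ^+ 2 <= g x * h x.
  rewrite /g; case: ifP => _; last by rewrite divfK // gt_eqF.
  by rewrite expr2 ler_pM2l // lerDl killing_ge0.
have G0 : (0 <= \esum_(x in [set: V]) (g x)%:E)%E.
  by apply: esum_ge0 => x _; rewrite lee_fin.
have Gfin : (\esum_(x in [set: V]) (g x)%:E < +oo)%E.
  rewrite (esumID K) => [|x _]; last by rewrite lee_fin.
  rewrite !setTI lte_add_pinfty //.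
    rewrite (@eq_esum _ _ _ _ (fun x => (m x)%:E)) // => x Kx.
    by rewrite /g mem_set.
  rewrite (@eq_esum _ _ _ _ (fun x => (m x ^+ 2 / h x)%:E)) // => x Kx.
  by rewrite /g memNset.
exists (fine (\esum_(x in [set: V]) (g x)%:E)); first exact: fine_ge0.
move=> r B t u r1 B1 t0 uB.
have k1 : 0 <= B `^ r * t by rewrite mulr_ge0 ?powR_ge0 // ltW.
have k2 : 0 <= B `^ r / t by rewrite divr_ge0 ?powR_ge0 // ltW.
have hu0 x : 0 <= h x * u x ^+ 2 by rewrite mulr_ge0 ?sqr_ge0 // ltW.
pose a x := (B `^ r * t * g x)%:E.
pose b x := (B `^ r / t * (h x * u x ^+ 2))%:E.
apply: (@le_trans _ _ (\esum_(x in [set: V]) (a x + b x)%E)).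
  apply: le_esum => x _; rewrite -EFinD lee_fin -!mulrA -mulrDr.
  apply: (@le_trans _ _ (m x * (B `^ r * `|u x|))).
    by rewrite ler_pM2l // powR_le_linear // normr_ge0 uB.
  rewrite mulrCA ler_wpM2l ?powR_ge0 //.
  exact: weighted_young (ltW (m_gt0 x)) (g0 x) (ltW (h_gt0 x)) t0 (mgh x).
rewrite esumD => [|x _|x _]; try by rewrite lee_fin mulr_ge0.
apply: leeD.
  by rewrite EFinM fineK ?ge0_fin_numE //; exact: esumZl_le.
apply: (le_trans (esumZl_le _ _ _ _ _ k2 hu0)).
by rewrite lee_wpmul2l ?lee_fin // esum_potential_le_energyN.
Qed.

End Embedding.

Theorem proposition3p8 (R : realType) (V : countType) (m : V -> R)
    (G : weighted_graph R V) (q : qform R V)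
    (V_infinite : infinite_set [set: V])
    (m_gt0 : forall x, 0 < m x)
    (q_closed : closed_form m q)
    (dom_dirichlet_q : qdom (dirichlet_form m G) `<=` qdom q)
    (dom_q_neumann : qdom q `<=` qdom (neumann_form m G))
    (q_neumann : forall u, qdom q u -> qval q u = qval (neumann_form m G) u)
    (standing : potential_blows_up m G)
    (G_compactifiable : canonically_compactifiable m G)
    (tail_finite :
       (ereal_inf [set \esum_(x in ~` K) (m x ^+ 2 / (m x + killing G x))%:E
                  | K in [set K : set V | mass m K < +oo]] < +oo)%E) :
  forall p : \bar R, (1 <= p)%E ->
    continuously_embedded (form_space q) (lp m p).
Proof.
have [[_ _ q_linear _ _] _] := q_closed.
have qB u v : qdom q u -> qdom q v -> qdom q (v \- u).
  move=> qu qv.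
  suff -> : v \- u = (fun x => -1 * u x + v x) by exact: q_linear.
  by apply/funext => x /=; lra.
have [dom_bounded sup_cont] := G_compactifiable.
have q_bounded u : qdom q u -> has_ubound (range (fun x => `|u x|)).
  by move=> /dom_q_neumann /dom_bounded.
have embed_linfty : continuously_embedded (form_space q) (l_infty R V).
  split=> [u /q_bounded //|u qu e e0].
  have [d d0 dP] := sup_cont u (dom_q_neumann _ qu) e e0.
  exists d => // v qv /= vu; apply: dP; first exact: dom_q_neumann.
  by move: vu; rewrite /= q_neumann //; exact: qB.
(* The exponent +oo is [embed_linfty], and -oo contradicts 1 <= p. *)
case=> [r| |] //; rewrite lee_fin => r1.
have r0 : 0 < r by lra.
have [M M0 MP] := esum_lp_le_energyN _ _ _ _ m_gt0 tail_finite.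
have q_energy u : qdom q u -> energyN m G u = (qval q u)%:E.
  move=> qu; have [_ ?] := dom_q_neumann _ qu.
  by rewrite q_neumann //= fineK // ge0_fin_numE ?energyN_ge0.
have lp_fin u : qdom q u -> fscarrier (lp_finite m r) u.
  move=> qu; have [C uC] := q_bounded u qu.
  (* Only finiteness matters here, so t = 1 will do; the maximum with 1 ensures B >= 1. *)
  have := MP r (Num.max C 1) 1 u r1 _ ltr01 _.
  rewrite q_energy // -EFinM -EFinD => /(_ _ _)/le_lt_trans; apply.
  - by rewrite le_max lexx orbT.
  - by move=> x; rewrite le_max uC //; exists x.
  - exact: ltry.
split=> [//|u qu e e0].
have er0 : 0 < e `^ r by rewrite powR_gt0.
(* Within [d1] the difference w is bounded by 1, so the estimate applies with B = 1 and the factor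
   B^r disappears. *)
have [d1 d1_gt0 d1P] := embed_linfty.2 u qu 1 ltr01.
(* The budget e^r is halved: [t] controls the term t M, with M + 1 guarding against M = 0, and [d2]
   is the threshold that makes q(w) / t < e^r / 2. *)
pose t := e `^ r / 2 / (M + 1).
have t0 : 0 < t by rewrite !divr_gt0 //; lra.
have tM : t * M <= e `^ r / 2.
  rewrite /t mulrAC ler_pdivrMr ?ltr_wpDl //.
  by rewrite ler_pM2l ?divr_gt0 // lerDl.
pose d2 := Num.sqrt (t * (e `^ r / 2)).
have te0 : 0 < t * (e `^ r / 2) by rewrite (mulr_gt0 t0) ?divr_gt0.
exists (Num.min d1 d2); first by rewrite lt_min d1_gt0 sqrtr_gt0 te0.
move=> v qv /=; rewrite lt_min => /andP[vd1 vd2].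
have qw := qB u v qu qv; set w := v \- u in qw vd1 vd2 *.
have w1 x : `|w x| <= 1.
  apply: le_trans (ltW (d1P v qv vd1)).
  by apply: ub_le_sup; [exact: q_bounded | exists x].
have qe : qval q w / t < e `^ r / 2.
  by rewrite ltr_pdivrMr // mulrC -ltr_sqrt.
set S := (\esum_(x in _) _)%E.
have S0 : (0 <= S)%E.
  by apply: esum_ge0 => x _; rewrite lee_fin mulr_ge0 ?powR_ge0 // ltW.
have Se : (S < (e `^ r)%:E)%E.
  apply: le_lt_trans (MP r 1 t w r1 (lexx _) t0 w1) _.
  by rewrite q_energy // -EFinM -EFinD lte_fin powR1 !mul1r; lra.
have fS : fine S < e `^ r.
  by rewrite -lte_fin fineK // ge0_fin_numE // (lt_trans Se) ?ltry.
(* The bound on the r-th powers passes to the norm by strict monotonicity of the power 1/r. *)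
have -> : e = (e `^ r) `^ r^-1 by rewrite -powRrM mulfV ?gt_eqF // powRr1 ?ltW.
by rewrite gt0_ltr_powR ?invr_gt0 // nnegrE ?fine_ge0 // ltW.
Qed.
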